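(* For every odd positive integer $k$, let $$\gamma_k=\sup\left\{\frac{\lambda_1(G)+\lambda_n(G)}{n} : G \text{ a finite simple graph on } n \text{ vertices with odd girth at least } k\right\}.$$ There exist constants $c_1,c_2>0$ such that for every odd positive integer $k$, $$c_1k^{-3}\le \gamma_k < c_2 k^{-1}.$$
   Context: For a finite simple graph $G$ on $n$ vertices, $\lambda_1(G)\ge\cdots\ge\lambda_n(G)$ denote the eigenvalues of its adjacency matrix. The odd girth of $G$ is the length of a shortest odd cycle in $G$; if $G$ is bipartite (has no odd cycle) its odd girth is $\infty$. *)

(* Defs.v *)
From HB Require Import structures.
From mathcomp Require Import all_boot all_order all_algebra.
From mathcomp Require Import spectral sesquilinear complex.
From mathcomp Require Import all_classical all_reals ereal.

Set Implicit Arguments.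
Unset Strict Implicit.
Unset Printing Implicit Defensive.

Import Order.TTheory GRing.Theory Num.Theory.
Local Open Scope classical_set_scope.
Local Open Scope ring_scope.

Record sgraph (n : nat) := SGraph {
  edge : rel 'I_n;
  edge_sym : symmetric edge;
  edge_irr : irreflexive edge }.

Definition adjmx (R : realType) (n : nat) (G : sgraph n) : 'M[R]_n :=
  \matrix_(i, j) (edge G i j)%:R.

(* s lists the eigenvalues of A with multiplicity, in nonincreasing order. *)
Definition spectrum (R : realType) (n : nat) (A : 'M[R]_n) (s : n.-tuple R) :=
  sorted >=%R s /\ char_poly A = \prod_(x <- s) ('X - x%:P).

(* The default value is irrelevant for symmetric A: see eigenvaluesP. *)
Definition eigenvalues (R : realType) (n : nat) (A : 'M[R]_n) : n.-tuple R :=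
  xget [tuple of nseq n 0] [set s | spectrum A s].

(* A cycle is the list of its vertices; the bound on the size excludes the
   closed walk x, y, x along a single edge. *)
Definition is_cycle (n : nat) (G : sgraph n) (c : seq 'I_n) : Prop :=
  ucycle (edge G) c /\ (3 <= size c)%N.

(* The infimum of the empty set is +oo, so bipartite graphs have odd girth
   +oo. *)
Definition odd_girth (R : realType) (n : nat) (G : sgraph n) : \bar R :=
  ereal_inf [set (size c)%:R%:E | c in [set c | is_cycle G c /\ odd (size c)]].

(* The vertex count is n.+1, since the ratio needs a positive number of
   vertices. *)
Definition gamma (R : realType) (k : nat) : \bar R :=
  ereal_sup [set y | exists (n : nat) (G : sgraph n.+1),
    (k%:R%:E <= odd_girth R G)%E /\
    y = ((tnth (eigenvalues (adjmx R G)) ord0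
          + tnth (eigenvalues (adjmx R G)) ord_max) / n.+1%:R)%:E].

Section SpectrumExists.
Local Open Scope sesquilinear_scope.

Lemma char_poly_similar (F : fieldType) (n : nat) (P D : 'M[F]_n) :
  P \in unitmx -> char_poly (invmx P *m D *m P) = char_poly D.
Proof.
move=> Pu; rewrite /char_poly /char_poly_mx.
set Q := map_mx polyC P.
have QV : map_mx polyC (invmx P) *m Q = 1%:M.
  by rewrite -map_mxM /= mulVmx // map_mx1.
have -> : 'X%:M - map_mx polyC (invmx P *m D *m P) =
    map_mx polyC (invmx P) *m ('X%:M - map_mx polyC D) *m Q.
  rewrite mulmxBr mulmxBl !map_mxM; congr (_ - _).
  by rewrite scalar_mxC -mulmxA QV mulmx1.
by rewrite !det_mulmx mulrAC -det_mulmx QV det1 mul1r.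
Qed.

Lemma spectrum_exists (R : realType) (n : nat) (A : 'M[R]_n) :
  A^T = A -> exists s : n.-tuple R, spectrum A s.
Proof.
move=> Asym; pose f := @real_complex_def R (Phant R).
pose B : 'M[R[i]]_n := map_mx f A.
have Bh : B \is hermsymmx.
  apply: realsym_hermsym.
    apply/is_hermitianmxP; rewrite expr0 scale1r map_mx_id //.
    by rewrite /B -{1}Asym map_trmx.
  by apply/mxOverP=> i j; rewrite mxE complex_real.
have /orthomx_spectralP BE := hermitian_normalmx Bh.
set d := spectral_diag B in BE.
have dR i : (complex.Re (d 0 i))%:C%C = d 0 i.
  have /mxOverP/(_ 0 i) := hermitian_spectral_diag_real Bh.
  by move=> /RRe_real.
pose u := [seq complex.Re (d 0 i) | i <- enum 'I_n].
have cp : char_poly A = \prod_(x <- u) ('X - x%:P).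
  apply: (map_inj_poly (f := f)); [by move=> x y [] | by [] |].
  rewrite map_char_poly -/B BE char_poly_similar ?spectral_unit //.
  rewrite char_poly_trig ?diag_mx_is_trig //.
  rewrite rmorph_prod /= /u big_map big_enum /=; apply: eq_bigr => i _.
  by rewrite rmorphB /= map_polyX map_polyC /= dR mxE eqxx mulr1n.
have sz : size (sort >=%R u) == n by rewrite size_sort size_map size_enum_ord.
exists (Tuple sz); split; first by apply: sort_sorted => x y; exact: le_total.
by rewrite cp; apply: perm_big; rewrite perm_sym perm_sort.
Qed.

End SpectrumExists.

Lemma eigenvaluesP (R : realType) (n : nat) (A : 'M[R]_n) :
  A^T = A -> spectrum A (eigenvalues A).
Proof.
move=> /spectrum_exists spA.
by have := xgetPex [tuple of nseq n 0] (P := [set s | spectrum A s]) spA.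
Qed.

Lemma adjmx_sym (R : realType) (n : nat) (G : sgraph n) :
  (adjmx R G)^T = adjmx R G.
Proof. by apply/matrixP => i j; rewrite !mxE edge_sym. Qed.

(* Main.v *)
Require Import Defs.
From mathcomp Require Import all_boot all_order all_algebra.
From mathcomp Require Import spectral sesquilinear complex.
From mathcomp Require Import all_classical all_reals ereal.
From mathcomp Require Import ring lra zify.

Set Implicit Arguments.
Unset Strict Implicit.
Unset Printing Implicit Defensive.

Import Order.TTheory GRing.Theory Num.Theory.
Local Open Scope ring_scope.

(** Upper bound: let a and -m be the extreme eigenvalues of a graph on N
    vertices with odd girth at least k = 2p+5. There is no closed walk of
    length 2p+3, so the eigenvalues x satisfy \sum x^(2p+3) = 0, while
    \sum x^2 <= N^2. Hence a^(2p+3) <= m^(2p+1) N^2, so a^(p+1) <= m^p N, and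
    a Bernoulli-type inequality gives p (a - m) <= N.

    Lower bound: for an odd cycle of length N, 2 is an eigenvalue. If a is an
    eigenvalue with eigenvector v, then
    (2 + a) \sum v_j^2 = \sum (v_j + v_(j+1))^2. Going once around the cycle,
    2 v_j is the alternating sum of the N terms v_i + v_(i+1), so
    Cauchy-Schwarz gives a >= -2 + 4/N^2. Length N = k+2 also covers k = 1,
    where no cycle of length k exists. *)

(** * Closed walks, odd cycles and vanishing traces *)

Section OddCycles.
Variables (n : nat) (G : sgraph n).

(* A repeated vertex splits an odd closed walk into two shorter closed walks,
   one of which is odd. *)
Lemma odd_closed_walk_cycle (c : seq 'I_n) :
  cycle (edge G) c -> odd (size c) ->
  exists c', [/\ is_cycle G c', odd (size c') & (size c' <= size c)%N].
Proof.
have [N] := ubnP (size c); elim: N c => // N IH c; rewrite ltnS => szN cyc odc.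
have [uc|/uniqPn] := boolP (uniq c).
  (* Length 1 would be a loop, so an odd closed walk without repetition has length at least 3. *)
  exists c; split=> //; split; first by rewrite /ucycle cyc.
  case: c {szN uc} cyc odc => [|x [|y [|z c]]] //=.
  by rewrite edge_irr.
have x0 : 'I_n by case: c odc {szN cyc}.
move=> /(_ x0) [i [j [ltij ltj eqij]]].
have lti : (i < size c)%N by apply: ltn_trans ltj.
(* After rotation the repeated vertex [x] comes first, and its second occurrence cuts the rest into
   [s1] and [s2]. *)
set x := nth x0 c i in eqij.
pose s := drop i.+1 c ++ take i c.
have rotE : rot i c = x :: s by rewrite /rot (drop_nth x0).
have xs : x \in s.
  rewrite mem_cat; apply/orP; left; rewrite eqij.
  have -> : nth x0 c j = nth x0 (drop i.+1 c) (j - i.+1).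
    by rewrite nth_drop subnKC.
  by apply: mem_nth; rewrite size_drop; lia.
have cs : cycle (edge G) (x :: s) by rewrite -rotE rot_cycle.
have ss : size (x :: s) = size c by rewrite -rotE size_rot.
move: cs ss; case/splitPr: xs => s1 s2 /=.
rewrite rcons_cat cat_path /= => /and3P[p1 e1 p2] ss.
have c1 : cycle (edge G) (x :: s1) by rewrite /= rcons_path p1 e1.
have c2 : cycle (edge G) (x :: s2) by [].
rewrite size_cat /= in ss.
have [o1|o2] : odd (size (x :: s1)) \/ odd (size (x :: s2)).
  move: odc; rewrite -ss /= oddD /=.
  by case: (odd (size s1)); case: (odd (size s2)); auto.
- have [|c' [h1 h2 h3]] := IH _ _ c1 o1; first by move=> /=; lia.
  by exists c'; split=> //; apply: leq_trans h3 _ => /=; lia.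
- have [|c' [h1 h2 h3]] := IH _ _ c2 o2; first by move=> /=; lia.
  by exists c'; split=> //; apply: leq_trans h3 _ => /=; lia.
Qed.

End OddCycles.

Lemma le_odd_girthP (R : realType) (n : nat) (G : sgraph n) (k : nat) :
  (k%:R%:E <= odd_girth R G)%E <->
  (forall c, is_cycle G c -> odd (size c) -> (k <= size c)%N).
Proof.
split=> [kG c cyc odc|kG].
  rewrite -(ler_nat R) -lee_fin; apply: le_trans kG _.
  by apply: ereal_inf_lbound; exists c.
apply: le_ereal_inf_tmp => _ [c [cyc odc] <-].
by rewrite lee_fin ler_nat; exact: kG.
Qed.

(** A nonzero entry of a matrix product has a nonzero summand, which supplies the first step of the
    walk. *)
Lemma adjmx_exp_walk (R : realType) (n : nat) (G : sgraph n.+1) (l : nat)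
    (i j : 'I_n.+1) :
  (adjmx R G ^+ l) i j != 0 ->
  exists p, [/\ path (edge G) i p, size p = l & last i p = j].
Proof.
elim: l i => [|l IH] i.
  rewrite expr0 mxE; case: (eqVneq i j) => [->|_]; last by rewrite eqxx.
  by exists [::].
rewrite exprS mxE => nz.
have [h eh] : exists h, adjmx R G i h * (adjmx R G ^+ l) h j != 0.
  apply: contrapT => /forallNP z; move/eqP: nz; apply; apply: big1 => h _.
  by apply/eqP; have /negP := z h; rewrite negbK.
move: eh; rewrite mulf_eq0 negb_or mxE => /andP[].
case: (boolP (edge G i h)) => [eih _|]; last by rewrite eqxx.
move=> /IH[p [pp sp lp]]; exists (h :: p); split=> //=; first by rewrite eih.
by rewrite sp.
Qed.

Lemma mxtrace_adjmx_exp_odd (R : realType) (n : nat) (G : sgraph n.+1)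
    (k l : nat) :
  (k%:R%:E <= odd_girth R G)%E -> odd l -> (l < k)%N ->
  \tr (adjmx R G ^+ l) = 0.
Proof.
move=> /le_odd_girthP kG ol lk; apply: big1 => i _.
apply/eqP; apply/negPn/negP => /adjmx_exp_walk[p [pp sp lp]].
(* [p] omits the start [i] of the walk but ends at [i], so [p] itself lists the closed walk. *)
have cyc : cycle (edge G) p.
  case: p pp sp lp => [//|y p] /= /andP[ey pp] _ lp.
  by rewrite rcons_path pp lp.
rewrite -sp in ol lk; have [c [h1 h2 h3]] := odd_closed_walk_cycle cyc ol.
by have := kG _ h1 h2; lia.
Qed.

(** * Traces of powers as power sums of eigenvalues *)

Lemma conjmx_exp (F : fieldType) (n : nat) (P D : 'M[F]_n.+1) (l : nat) :
  P \in unitmx -> (invmx P *m D *m P) ^+ l = invmx P *m D ^+ l *m P.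
Proof.
move=> Pu; elim: l => [|l IH]; first by rewrite !expr0 mulmx1 mulVmx.
rewrite !exprS IH -![_ * _]/(_ *m _) !mulmxA; congr (_ *m _ *m _).
by rewrite -!mulmxA mulmxV // mulmx1.
Qed.

Lemma diag_mx_exp (F : fieldType) (n : nat) (d : 'rV[F]_n.+1) (l : nat) :
  diag_mx d ^+ l = diag_mx (\row_i d 0 i ^+ l).
Proof.
elim: l => [|l IH].
  by apply/matrixP=> i j; rewrite !mxE; case: eqP.
rewrite exprS IH -[LHS]/(_ *m _) mulmx_diag; congr diag_mx.
by apply/rowP => i; rewrite !mxE exprS.
Qed.

Section TracePowers.
Local Open Scope sesquilinear_scope.

(** Over the complex numbers [A] is unitarily diagonalisable. The diagonal and [s] give the same
    characteristic polynomial, so they agree up to order, and conjugation preserves the trace. *)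
Lemma mxtrace_exp_spectrum (R : realType) (n : nat) (A : 'M[R]_n.+1)
    (s : n.+1.-tuple R) (l : nat) :
  A^T = A -> spectrum A s -> \tr (A ^+ l) = \sum_(x <- s) x ^+ l.
Proof.
move=> Asym [_ cpA]; pose f := @real_complex_def R (Phant R).
pose B : 'M[R[i]]_n.+1 := map_mx f A.
have Bh : B \is hermsymmx.
  apply: realsym_hermsym.
    apply/is_hermitianmxP; rewrite expr0 scale1r map_mx_id //.
    by rewrite /B -{1}Asym map_trmx.
  by apply/mxOverP=> i j; rewrite mxE complex_real.
have /orthomx_spectralP BE := hermitian_normalmx Bh.
set d := spectral_diag B in BE.
have Pu : spectralmx B \in unitmx by exact: spectral_unit.
have perm_ds : perm_eq [seq d 0 i | i <- enum 'I_n.+1] (map f s).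
  have : \prod_(x <- [seq d 0 i | i <- enum 'I_n.+1]) ('X - x%:P) =
         \prod_(x <- map f s) ('X - x%:P).
    transitivity (char_poly B).
      rewrite [in RHS]BE char_poly_similar //.
      rewrite char_poly_trig ?diag_mx_is_trig //.
      rewrite big_map big_enum /=; apply: eq_bigr => i _.
      by rewrite mxE eqxx mulr1n.
    rewrite /B -map_char_poly cpA rmorph_prod /= big_map; apply: eq_bigr => x _.
    by rewrite rmorphB /= map_polyX map_polyC.
  exact: prod_XsubC_eq.
have trE : \tr (B ^+ l) = \sum_i d 0 i ^+ l.
  rewrite BE conjmx_exp // mxtrace_mulC mulmxA mulmxV // mul1mx diag_mx_exp.
  by rewrite mxtrace_diag; apply: eq_bigr => i _; rewrite mxE.
apply: (fmorph_inj f); rewrite -trace_map_mx.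
have -> : map_mx f (A ^+ l) = B ^+ l by exact: rmorphXn.
rewrite trE rmorph_sum /=.
rewrite -(big_enum _ _ _ (fun i => d 0 i ^+ l)) /=.
rewrite -(big_map (d 0) xpredT (fun x => x ^+ l)) (perm_big _ perm_ds) big_map.
by apply: eq_bigr => x _; rewrite rmorphXn.
Qed.
End TracePowers.

(** * Upper bound on the sum of the extreme eigenvalues *)

(** Induction on [p], splitting [b ^+ p.+2] as [a * b ^+ p.+1 + (b - a) * b ^+ p.+1]. *)
Lemma mul_subr_exp_le (R : realDomainType) (a b : R) (p : nat) :
  0 <= a -> a <= b -> p%:R * (b - a) * a ^+ p <= b ^+ p.+1.
Proof.
move=> a0 ab; elim: p => [|p IH]; first by rewrite !mul0r expr1; lra.
have apb : a ^+ p.+1 <= b ^+ p.+1 by apply: lerXn2r => //; rewrite nnegrE; lra.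
have h1 : a * (p%:R * (b - a) * a ^+ p) <= a * b ^+ p.+1 by apply: ler_wpM2l.
have h2 : (b - a) * a ^+ p.+1 <= (b - a) * b ^+ p.+1.
  by apply: ler_wpM2l => //; lra.
rewrite -natr1 [b ^+ p.+2]exprS; move: h1 h2; rewrite [a ^+ p.+1]exprS; lra.
Qed.

Section SpectrumBounds.
Variables (R : realType) (n : nat).

Lemma sorted_tuple_bounds (s : n.+1.-tuple R) (x : R) :
  sorted >=%R s -> x \in tval s -> tnth s ord_max <= x <= tnth s ord0.
Proof.
move=> srt xs; have ge_trans : transitive (>=%R : rel R).
  by move=> a b c ba cb; exact: le_trans cb ba.
have nth_ge i j : (i <= j <= n)%N -> nth 0 s j <= nth 0 s i.
  move=> /andP[ij jn].
  apply: (sorted_leq_nth ge_trans (@lexx _ R) 0 srt) => //;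
  by rewrite inE size_tuple; lia.
rewrite !(tnth_nth 0) /= -(nth_index 0 xs).
have : (index x s < n.+1)%N by rewrite -{2}(size_tuple s) index_mem.
by rewrite ltnS => ix; rewrite !nth_ge ?ix ?leqnn.
Qed.

Lemma eigenvalue_spectrum (A : 'M[R]_n.+1) (s : n.+1.-tuple R) (x : R) :
  spectrum A s -> eigenvalue A x = (x \in tval s).
Proof. by move=> [_ cpA]; rewrite eigenvalue_root_char cpA root_prod_XsubC. Qed.

Lemma mxtrace_adjmx_sqr_le (G : sgraph n.+1) :
  \tr (adjmx R G ^+ 2) <= n.+1%:R ^+ 2.
Proof.
rewrite expr2 [leRHS]expr2 -natrM.
have -> : ((n.+1 * n.+1)%:R : R) = \sum_(i < n.+1) \sum_(j < n.+1) 1.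
  by rewrite !sumr_const card_ord -mulrnA.
apply: ler_sum => i _; rewrite mxE; apply: ler_sum => j _.
by rewrite !mxE; case: edge; case: edge; rewrite ?mulr1 ?mulr0 ?lexx ?ler01.
Qed.

Lemma extremal_sum_le_of_odd_power_sum0 (s : n.+1.-tuple R) (N : R) (p : nat) :
  sorted >=%R s -> 0 <= N -> \sum_(x <- s) x ^+ 2 <= N ^+ 2 ->
  \sum_(x <- s) x ^+ (p.*2.+3) = 0 ->
  (0 < p)%N -> p%:R * (tnth s ord0 + tnth s ord_max) <= N.
Proof.
move=> srt N0 sum2 sum0 p0.
have bnd x : x \in tval s -> tnth s ord_max <= x <= tnth s ord0.
  exact: sorted_tuple_bounds.
set a := tnth s ord0 in bnd *; set v := tnth s ord_max in bnd *.
have a_s : a \in tval s by exact: mem_tnth.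
have [av|av] := leP (a + v) 0.
  by apply: le_trans N0; rewrite mulr_ge0_le0.
have od : odd p.*2.+1 by rewrite /= odd_double.
(* If the least eigenvalue were positive, the sum of odd powers would be positive. *)
have v0 : v <= 0.
  rewrite leNgt; apply/negP => v0; move/eqP: sum0; apply/negP.
  rewrite gt_eqF //; apply: (@lt_le_trans _ _ (a ^+ p.*2.+3)).
    by rewrite exprn_gt0 //; have := bnd _ a_s; lra.
  rewrite (big_rem a) //= lerDl big_seq; apply: sumr_ge0 => x /mem_rem /bnd h.
  by apply: exprn_ge0; lra.
pose m := - v.
have m0 : 0 <= m by rewrite /m; lra.
have ma : m <= a by rewrite /m; lra.
have a0 : 0 < a by rewrite /m in ma *; lra.
(* The weight [m ^+ p.*2.+1] compensates the negative odd powers, since every eigenvalue is at least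
   [- m]. All terms but that of [a] can then be dropped. *)
have term_ge0 x : x \in tval s -> 0 <= x ^+ p.*2.+3 + m ^+ p.*2.+1 * x ^+ 2.
  move=> /bnd /andP[vx _].
  have -> : x ^+ p.*2.+3 = x ^+ p.*2.+1 * x ^+ 2 by rewrite -exprD addn2.
  rewrite -mulrDl mulr_ge0 ?sqr_ge0 //.
  have [x0|x0] := leP 0 x; first by rewrite addr_ge0 ?exprn_ge0.
  have -> : x ^+ p.*2.+1 = - (- x) ^+ p.*2.+1.
    by rewrite exprNn -signr_odd od expr1 mulN1r opprK.
  by rewrite addrC subr_ge0; apply: lerXn2r; rewrite ?nnegrE /m; lra.
have key : a ^+ p.*2.+3 <= m ^+ p.*2.+1 * N ^+ 2.
  have : a ^+ p.*2.+3 <=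
      \sum_(x <- s) (x ^+ p.*2.+3 + m ^+ p.*2.+1 * x ^+ 2).
    rewrite (big_rem a) //=; apply: ler_wpDr.
      by rewrite big_seq; apply: sumr_ge0 => x /mem_rem; exact: term_ge0.
    by rewrite lerDl mulr_ge0 ?exprn_ge0 ?sqr_ge0 //; lra.
  move/le_trans; apply; rewrite big_split /= sum0 add0r -mulr_sumr.
  by apply: ler_wpM2l => //; exact: exprn_ge0.
(* Compare squares after multiplying by [a]: one factor [m] in [key] is replaced by the larger
   [a]. *)
have key2 : a ^+ p.+1 <= m ^+ p * N.
  rewrite -(@ler_pXn2r _ 2) ?nnegrE ?mulr_ge0 ?exprn_ge0 //; last by lra.
  rewrite -(ler_pM2r a0) -exprM muln2 -exprSr doubleS.
  apply: le_trans key _; rewrite exprMn -exprM muln2 [m ^+ _.+1]exprSr.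
  rewrite mulrAC; apply: ler_wpM2l => //.
  by rewrite mulr_ge0 ?sqr_ge0 ?exprn_ge0.
have [m_gt0|m_le0] := ltP 0 m.
  have mp0 : 0 < m ^+ p by exact: exprn_gt0.
  rewrite -(ler_pM2r mp0) [leRHS]mulrC; apply: le_trans key2.
  by have := mul_subr_exp_le p m0 ma; rewrite /m opprK.
(* Here [m ^+ p] cannot be cancelled, but as [p] is positive [key2] would force [a ^+ p.+1 <= 0]. *)
have mE : m = 0 by lra.
move: key2; rewrite mE expr0n gtn_eqF // mul0r leNgt.
by rewrite exprn_gt0.
Qed.

End SpectrumBounds.

Lemma extremal_eigenvalues_sum_le (R : realType) (n : nat) (G : sgraph n.+1)
    (k : nat) :
  odd k -> (k%:R%:E <= odd_girth R G)%E ->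
  k%:R * (tnth (eigenvalues (adjmx R G)) ord0
          + tnth (eigenvalues (adjmx R G)) ord_max) <= 10 * n.+1%:R.
Proof.
move=> odk kG; have Asym := adjmx_sym R G.
have spA := eigenvaluesP Asym; set s := eigenvalues _ in spA *.
have srt : sorted >=%R s by case: spA.
have N0 : 0 <= n.+1%:R :> R by exact: ler0n.
have sum2 : \sum_(x <- s) x ^+ 2 <= n.+1%:R ^+ 2.
  by rewrite -(mxtrace_exp_spectrum _ Asym spA) mxtrace_adjmx_sqr_le.
(* For small [k] the exponent argument would give [p = 0] at best; instead each eigenvalue is at
   most the number of vertices, and 10 is 5 times 2. *)
have [k5|k5] := leqP k 5.
  have s_le x : x \in tval s -> x <= n.+1%:R.
    move=> xs; apply: le_trans (ler_norm x) _.
    rewrite -(@ler_pXn2r _ 2) ?nnegrE // real_normK ?num_real //.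
    apply: le_trans sum2; rewrite (big_rem x) //= lerDl.
    by apply: sumr_ge0 => y _; exact: sqr_ge0.
  have h0 := s_le _ (mem_tnth ord0 s); have h1 := s_le _ (mem_tnth ord_max s).
  have k0 : 0 <= k%:R :> R by exact: ler0n.
  have kr : k%:R <= 5 :> R by rewrite (ler_nat R k 5).
  apply: (@le_trans _ _ (k%:R * (2 * n.+1%:R))).
    by apply: ler_wpM2l => //; lra.
  by rewrite mulrA; apply: ler_wpM2r => //; lra.
(* Then [p.*2.+3] is [k - 2], the largest odd number below [k]. *)
pose p := (k - 5)./2.
have kE : k = (p.*2 + 5)%N by rewrite /p; lia.
have p0 : (0 < p)%N by lia.
have sum0 : \sum_(x <- s) x ^+ p.*2.+3 = 0.
  rewrite -(mxtrace_exp_spectrum _ Asym spA).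
  by apply: (mxtrace_adjmx_exp_odd kG); lia.
have := extremal_sum_le_of_odd_power_sum0 srt N0 sum2 sum0 p0.
set d := _ + _ => pd.
have [d0|d0] := leP d 0.
  by apply: (@le_trans _ _ 0); rewrite ?mulr_ge0 ?mulr_ge0_le0.
(* Since [p] is at least 1, [k = 2p + 5] is at most [10p]. *)
apply: (@le_trans _ _ (10 * (p%:R * d))); last by apply: ler_wpM2l.
rewrite mulrA; apply: ler_wpM2r; first exact: ltW.
by rewrite -natrM ler_nat; lia.
Qed.

Lemma gamma_le (R : realType) (k : nat) :
  odd k -> (gamma R k <= (10 * k%:R^-1)%:E)%E.
Proof.
move=> odk; apply: ge_ereal_sup => _ [n [G [kG ->]]]; rewrite lee_fin.
have k0 : 0 < k%:R :> R by rewrite ltr0n; case: k odk {kG}.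
have n0 : 0 < n.+1%:R :> R by rewrite ltr0n.
rewrite ler_pdivrMr // mulrAC ler_pdivlMr // mulrC.
exact: extremal_eigenvalues_sum_le.
Qed.

(** * Odd cycles and the lower bound *)

(** Cauchy-Schwarz against the all-ones vector, obtained without division from the squares of
    [m u_i - S]. *)
Lemma sqr_sum_le (R : realDomainType) (m : nat) (u : 'I_m -> R) :
  (\sum_i u i) ^+ 2 <= m%:R * \sum_i u i ^+ 2.
Proof.
case: m u => [|m] u; first by rewrite !big_ord0 mulr0 expr0n.
set S := \sum_i u i; set Q := \sum_i _.
have : 0 <= \sum_i (m.+1%:R * u i - S) ^+ 2.
  by apply: sumr_ge0 => i _; exact: sqr_ge0.
have -> : \sum_i (m.+1%:R * u i - S) ^+ 2 = m.+1%:R * (m.+1%:R * Q - S ^+ 2).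
  under eq_bigr => i _.
    have -> : (m.+1%:R * u i - S) ^+ 2 =
      m.+1%:R ^+ 2 * u i ^+ 2 + (- 2 * m.+1%:R * S) * u i + S ^+ 2 by ring.
    over.
  rewrite !big_split /= -!mulr_sumr -/S -/Q sumr_const card_ord.
  by rewrite -[_ *+ _]mulr_natl; ring.
by rewrite pmulr_rge0 ?ltr0n // subr_ge0.
Qed.

Lemma alternating_telescope (R : comNzRingType) (w : nat -> R) (m : nat) :
  \sum_(t < m) (-1) ^+ t * (w t + w t.+1) = w 0 - (-1) ^+ m * w m.
Proof.
elim: m => [|m IH]; first by rewrite big_ord0 expr0 mul1r subrr.
by rewrite big_ord_recr /= IH exprS; ring.
Qed.

Section CycleGraph.
Variable k : nat.
Local Notation N := k.+2.

(** Addition in ['I_N] is modulo [N], so the edge closing the cycle is included. *)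
Definition cycle_edge : rel 'I_N := fun i j => (j == i + 1) || (i == j + 1).

Lemma cycle_edge_sym : symmetric cycle_edge.
Proof. by move=> i j; rewrite /cycle_edge orbC. Qed.

Lemma cycle_edge_irr : irreflexive cycle_edge.
Proof.
by move=> i; rewrite /cycle_edge orbb -[X in X == _]addr0 (inj_eq (addrI i)).
Qed.

Definition cycle_graph := SGraph cycle_edge_sym cycle_edge_irr.

Lemma natr_ord_inj (a b : nat) :
  (a < N)%N -> (b < N)%N -> a%:R = b%:R :> 'I_N -> a = b.
Proof.
move=> aN bN /(congr1 (@nat_of_ord _)).
rewrite (@val_Zp_nat N isT a) (@val_Zp_nat N isT b).
by rewrite !modn_small.
Qed.

(** [a] counts the forward steps and [b] the backward ones. *)
Lemma cycle_path_steps (p : seq 'I_N) (i : 'I_N) :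
  path cycle_edge i p ->
  exists a b, (a + b = size p)%N /\ last i p + b%:R = i + a%:R.
Proof.
elim: p i => [|j p IH] i /=; first by exists 0, 0.
move=> /andP[/orP[/eqP ->|/eqP ->] /IH[a [b [<- e]]]].
  exists a.+1, b; split; first by rewrite addSn.
  by rewrite e -natr1 addrA addrAC.
exists a, b.+1; split; first by rewrite addnS.
by rewrite -natr1 addrA e addrAC.
Qed.

(** A closed walk takes equally many forward and backward steps modulo [N]. If it is shorter than
    [N], the two numbers are equal and its length is even. *)
Lemma cycle_graph_odd_girth (R : realType) :
  (k.+2%:R%:E <= odd_girth R cycle_graph)%E.
Proof.
apply/le_odd_girthP => -[|x p] [/andP[cyc _] _] // odc.
have [a [b []]] := cycle_path_steps cyc.
rewrite last_rcons size_rcons => sab /addrI e.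
rewrite leqNgt; apply/negP => /= lt.
have ba : b = a by apply: natr_ord_inj => //; lia.
by move: odc; rewrite -[size (x :: p)]sab ba addnn odd_double.
Qed.

Hypothesis k_gt0 : (0 < k)%N.
Variable R : realType.

Lemma mulmx_cycle_graph (v : 'rV[R]_N) (j : 'I_N) :
  (v *m adjmx R cycle_graph) 0 j = v 0 (j - 1) + v 0 (j + 1).
Proof.
rewrite mxE.
(* The two neighbours coincide only if [2 = 0] modulo [N], which [k_gt0] excludes. *)
have ne : j - 1 != j + 1.
  rewrite (inj_eq (addrI j)) eq_sym -addr_eq0.
  apply/negP => /eqP e; have : 2%:R = 0%:R :> 'I_N by [].
  by move/natr_ord_inj => e2; have := e2 k_gt0 isT.
have adjE i : adjmx R cycle_graph i j = (i == j - 1)%:R + (i == j + 1)%:R.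
  rewrite mxE /= /cycle_edge -subr_eq [j - 1 == i]eq_sym.
  case: (eqVneq i (j - 1)) => [->|_] /=; last by rewrite add0r.
  by rewrite (negPf ne) addr0.
under eq_bigr => i _ do rewrite adjE mulrDr.
rewrite big_split /=; congr (_ + _).
  rewrite (bigD1 (j - 1)) //= eqxx mulr1 big1 ?addr0 // => i /negPf ->.
  by rewrite mulr0.
rewrite (bigD1 (j + 1)) //= eqxx mulr1 big1 ?addr0 // => i /negPf ->.
by rewrite mulr0.
Qed.

Lemma cycle_graph_eigenvalue2 : eigenvalue (adjmx R cycle_graph) 2.
Proof.
apply/eigenvalueP; exists (const_mx 1).
  by apply/rowP => j; rewrite mulmx_cycle_graph !mxE mulr1.
by apply/eqP => /rowP /(_ 0); rewrite !mxE => /eqP; rewrite oner_eq0.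
Qed.

Lemma sum_shift (F : 'I_N -> R) (c : 'I_N) : \sum_j F (j + c) = \sum_j F j.
Proof. by rewrite [RHS](reindex_inj (addIr c)). Qed.

Lemma cycle_coord_sqr_le (v : 'I_N -> R) (j : 'I_N) :
  odd N -> 4 * v j ^+ 2 <= N%:R * \sum_i (v i + v (i + 1)) ^+ 2.
Proof.
move=> odN; pose D i := v i + v (i + 1).
have tel : \sum_(t < N) (-1) ^+ t * D (j + t) = 2 * v j.
  have N0 : N%:R = 0 :> 'I_N := @pchar_Zp N isT.
  (* The walk returns to [j] after [N] steps, and the odd sign turns the difference of end terms
     into [2 * v j]. *)
  transitivity (v (j + 0%:R) - (-1) ^+ N * v (j + N%:R)); last first.
    by rewrite -signr_odd odN expr1 N0 addr0; ring.
  rewrite -(alternating_telescope (fun t => v (j + t%:R))).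
  apply: eq_bigr => t _; congr (_ * _).
  by rewrite /D -natr1 natr_Zp addrA.
have := sqr_sum_le (fun t : 'I_N => (-1) ^+ t * D (j + t)).
rewrite tel exprMn -natrX => /le_trans; apply.
apply: ler_wpM2l => //; rewrite -(sum_shift (fun i => D i ^+ 2) j).
apply: ler_sum => t _.
by rewrite exprMn -exprM mulnC exprM sqrrN expr1n expr1n mul1r addrC.
Qed.

Lemma cycle_graph_eigenvalue_ge (a : R) :
  odd N -> eigenvalue (adjmx R cycle_graph) a -> -2 + 4 / N%:R ^+ 2 <= a.
Proof.
move=> odN /eigenvalueP[v va v0]; pose S := \sum_j v 0 j ^+ 2.
have S0 : 0 < S.
  have /rV0Pn[j vj] := v0.
  rewrite /S (bigD1 j) //= ltr_pwDl ?sumr_ge0 // => [|i _]; last exact: sqr_ge0.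
  by rewrite lt_neqAle sqr_ge0 eq_sym sqrf_eq0 vj.
pose T := \sum_j v 0 j * v 0 (j + 1).
(* Pair the eigenvector equation with [v]; both neighbour sums equal [T] after a shift. *)
have aS : a * S = 2 * T.
  rewrite /S mulr_sumr.
  transitivity (\sum_j (v 0 (j - 1) * v 0 j + v 0 j * v 0 (j + 1))).
    apply: eq_bigr => j _; have /rowP/(_ j) := va.
    rewrite mulmx_cycle_graph mxE => e; rewrite expr2 mulrA -e; ring.
  rewrite big_split /= -/T -(sum_shift _ 1).
  under eq_bigr => j _ do rewrite addrK.
  by rewrite -/T; ring.
have E : \sum_i (v 0 i + v 0 (i + 1)) ^+ 2 = (2 + a) * S.
  under eq_bigr => i _.
    have -> : (v 0 i + v 0 (i + 1)) ^+ 2 =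
      v 0 i ^+ 2 + v 0 (i + 1) ^+ 2 + 2 * (v 0 i * v 0 (i + 1)) by ring.
    over.
  rewrite !big_split /= -mulr_sumr -/T (sum_shift (fun i => v 0 i ^+ 2)) -/S.
  by rewrite -aS; ring.
(* Summing the coordinate bound over all [N] vertices gives the second factor [N]. *)
have : 4 * S <= N%:R ^+ 2 * ((2 + a) * S).
  rewrite -E expr2 -mulrA /S mulr_sumr.
  have coord_le := cycle_coord_sqr_le (fun i => v 0 i) _ odN.
  apply: le_trans (ler_sum _ (fun j _ => coord_le j)) _.
  by rewrite sumr_const card_ord -[_ *+ _]mulr_natl.
rewrite mulrA ler_pM2r // mulrC -ler_pdivrMr ?exprn_gt0 ?ltr0n //.
by rewrite [-2 + _]addrC lerBlDl.
Qed.

End CycleGraph.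

Lemma gamma_ge (R : realType) (k : nat) :
  odd k -> ((4 / 27 * k%:R ^- 3)%:E <= gamma R k)%E.
Proof.
move=> odk; have k0 : (0 < k)%N by case: k odk.
set G := cycle_graph k; have Asym := adjmx_sym R G.
have spA := eigenvaluesP Asym.
have N0 : 0 < k.+2%:R :> R by rewrite ltr0n.
have kr0 : 0 < k%:R :> R by rewrite ltr0n.
have k1 : 1 <= k%:R :> R by rewrite (ler_nat R 1).
pose t i := tnth (eigenvalues (adjmx R G)) i.
apply: le_ereal_sup_tmp; exists ((t ord0 + t ord_max) / k.+2%:R)%:E.
  exists k.+1, G; split=> //; apply: le_trans _ (cycle_graph_odd_girth k R).
  by rewrite lee_fin ler_nat; lia.
rewrite lee_fin ler_pdivlMr //.
have h0 : 2 <= t ord0.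
  have := cycle_graph_eigenvalue2 k0 R; rewrite (eigenvalue_spectrum _ spA).
  by move=> /(sorted_tuple_bounds (proj1 spA))/andP[].
have h1 : -2 + 4 / k.+2%:R ^+ 2 <= t ord_max.
  apply: (cycle_graph_eigenvalue_ge k0); first by rewrite /= negbK.
  by rewrite (eigenvalue_spectrum _ spA) mem_tnth.
(* By [h0] and [h1] the ratio is at least [4 / N^3] with [N = k + 2], and [N <= 3k] gives the
   constant [4 / 27]. *)
have h2 : 4 / 27 * k%:R ^- 3 * k.+2%:R <= 4 / k.+2%:R ^+ 2 :> R.
  have N3k : k.+2%:R <= 3 * k%:R :> R by rewrite -addn2 natrD; lra.
  rewrite ler_pdivlMr ?exprn_gt0 // -[_ * _ * k.+2%:R ^+ 2]mulrA -exprS mulrAC.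
  rewrite ler_pdivrMr ?exprn_gt0 //.
  have : k.+2%:R ^+ 3 <= (3 * k%:R) ^+ 3 :> R.
    by apply: lerXn2r; rewrite ?nnegrE //; lra.
  rewrite exprMn; lra.
apply: le_trans h2 _; move: h0 h1; move: (4 / _) (t _) (t _) => q x y; lra.
Qed.

Theorem theorem1p3 (R : realType) :
  exists c1 c2 : R, 0 < c1 /\ 0 < c2 /\
    forall k : nat, odd k ->
      ((c1 * k%:R ^- 3)%:E <= gamma R k)%E /\
      (gamma R k < (c2 * k%:R^-1)%:E)%E.
Proof.
(* The supremum is only known to be at most [10 / k]; taking 11 makes the inequality strict. *)
exists (4 / 27), 11; split; [lra | split; [lra |]] => k odk.
split; first exact: gamma_ge.
apply: le_lt_trans (gamma_le R odk) _; rewrite lte_fin ltr_pM2r; first by lra.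
by rewrite invr_gt0 ltr0n; case: k odk.
Qed.
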